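(* Let $n$ be a positive integer. Let $X_n$ be the right-angled Artin group generated by $x_{i,j}$ for $1\le i\neq j\le n$, where all generators commute with each other except the pairs $x_{i,j}$ and $x_{j,i}$ for $1\le i\neq j\le n$ (that is, the defining relations are $x_{i,j}x_{k,l}=x_{k,l}x_{i,j}$ for all pairs of generators with $(k,l)\neq (j,i)$). Then the unrestricted virtual braid group $UVB_n$ is isomorphic to the semidirect product $X_n\rtimes S_n$, where the symmetric group $S_n$ acts on $X_n$ by permutation of the indices of the generators, $s\cdot x_{i,j}=x_{s(i),s(j)}$.
   Context: The group of unrestricted virtual braids $UVB_n$ is the group with generators $\sigma_1,\dots,\sigma_{n-1},\rho_1,\dots,\rho_{n-1}$ and defining relations: (R1) $\sigma_i\sigma_{i+1}\sigma_i=\sigma_{i+1}\sigma_i\sigma_{i+1}$ for $1\le i\le n-2$; (R2) $\sigma_i\sigma_j=\sigma_j\sigma_i$ for $|i-j|\ge 2$; (R3) $\rho_i\rho_{i+1}\rho_i=\rho_{i+1}\rho_i\rho_{i+1}$ for $1\le i\le n-2$; (R4) $\rho_i\rho_j=\rho_j\rho_i$ for $|i-j|\ge 2$; (R5) $\rho_i^2=1$ for $1\le i\le n-1$; (R6) $\sigma_i\rho_j=\rho_j\sigma_i$ for $|i-j|\ge 2$; (M) $\rho_i\rho_{i+1}\sigma_i=\sigma_{i+1}\rho_i\rho_{i+1}$ for $1\le i\le n-2$; (F1) $\rho_i\sigma_{i+1}\sigma_i=\sigma_{i+1}\sigma_i\rho_{i+1}$ for $1\le i\le n-2$; (F2) $\rho_{i+1}\sigma_i\sigma_{i+1}=\sigma_i\sigma_{i+1}\rho_i$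 for $1\le i\le n-2$. *)

(* Defs.v *)
(* Word problems are undecidable in general, so equality on presented groups is
   decided classically. *)
From HB Require Import structures.
From mathcomp Require Import all_boot all_fingroup.
From mathcomp Require Import boolp generic_quotient.

Set Implicit Arguments.
Unset Strict Implicit.
Unset Printing Implicit Defensive.

Local Open Scope group_scope.
Local Open Scope quotient_scope.

Section Presentation.
Variable I : choiceType.

(* The letter (a, true) stands for the generator a, (a, false) for a^-1. *)
Definition word : Type := seq (I * bool).
HB.instance Definition _ := Choice.on word.

Implicit Types (u v w : word) (R : word -> word -> Prop).

Definition flip (l : I * bool) : I * bool := (l.1, ~~ l.2).
Definition word_inv w : word := rev (map flip w).

Inductive word_eq R : word -> word -> Prop :=
| word_eq_refl u : word_eq R u u
| word_eq_sym u v : word_eq R u v -> word_eq R v u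
| word_eq_trans u v w : word_eq R u v -> word_eq R v w -> word_eq R u w
| word_eq_cat u u' v v' :
    word_eq R u u' -> word_eq R v v' -> word_eq R (u ++ v) (u' ++ v')
| word_eq_cancel l : word_eq R [:: l; flip l] [::]
| word_eq_rel u v : R u v -> word_eq R u v.

Variable R : word -> word -> Prop.

Definition word_eqb : rel word := fun u v => `[< word_eq R u v >].

Lemma word_eqb_equiv : equiv_class_of word_eqb.
Proof.
split=> [u|u v|v u w].
- exact/asboolP/word_eq_refl.
- by apply/asboolP/asboolP; apply: word_eq_sym.
- by move=> /asboolP uv /asboolP vw; apply/asboolP; apply: word_eq_trans vw.
Qed.

Canonical word_equiv := EquivRelPack word_eqb_equiv.

(* The group < I | u = v for all u, v such that R u v >. *)
Definition presented : Type := {eq_quot word_equiv}.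
HB.instance Definition _ := Choice.on presented.
HB.instance Definition _ := Quotient.on presented.

Implicit Types x y z : presented.

Definition word_class u : presented := \pi_presented u.

Lemma word_classP u v : word_class u = word_class v <-> word_eq R u v.
Proof.
split; first by move/eqmodP/asboolP.
by move=> uv; apply/eqmodP/asboolP.
Qed.

Lemma word_classK x : word_class (repr x) = x.
Proof. exact: reprK. Qed.

Lemma word_reprP u : word_eq R (repr (word_class u)) u.
Proof. by apply/word_classP; rewrite word_classK. Qed.

Lemma flipK : involutive flip.
Proof. by case=> a b; rewrite /flip /= negbK. Qed.

Lemma word_inv_cons l w : word_inv (l :: w) = word_inv w ++ [:: flip l].
Proof. by rewrite /word_inv /= rev_cons -cats1. Qed.

Lemma word_inv_cat u v : word_inv (u ++ v) = word_inv v ++ word_inv u.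
Proof. by rewrite /word_inv map_cat rev_cat. Qed.

Lemma word_invK : involutive word_inv.
Proof. by move=> w; rewrite /word_inv map_rev revK mapK //; apply: flipK. Qed.

Lemma word_mulV w : word_eq R (w ++ word_inv w) [::].
Proof.
elim: w => [|l w IHw]; first exact: word_eq_refl.
rewrite word_inv_cons catA -[[::]]/([::] ++ [::]) /=.
apply: word_eq_trans (word_eq_cancel R l).
rewrite -[l :: _]/([:: l] ++ ((w ++ word_inv w) ++ [:: flip l])).
apply: (word_eq_cat (word_eq_refl _ [:: l])).
exact: word_eq_cat IHw (word_eq_refl _ _).
Qed.

Lemma word_mulVw w : word_eq R (word_inv w ++ w) [::].
Proof. by rewrite -{2}[w]word_invK; apply: word_mulV. Qed.

Lemma word_eq_inv u v : word_eq R u v -> word_eq R (word_inv u) (word_inv v).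
Proof.
move=> uv.
have h1 : word_eq R (word_inv u) (word_inv u ++ v ++ word_inv v).
  rewrite -{1}[word_inv u]cats0; apply: word_eq_cat (word_eq_refl _ _) _.
  exact/word_eq_sym/word_mulV.
apply: word_eq_trans h1 _; rewrite catA -[X in word_eq R _ X]cat0s.
apply: word_eq_cat (word_eq_refl _ _).
apply: word_eq_trans (word_mulVw u).
exact: word_eq_cat (word_eq_refl _ _) (word_eq_sym uv).
Qed.

Definition pmul x y : presented := word_class (repr x ++ repr y).
Definition pone : presented := word_class [::].
Definition pinv x : presented := word_class (word_inv (repr x)).

Lemma pmulE u v :
  pmul (word_class u) (word_class v) = word_class (u ++ v).
Proof. by apply/word_classP; apply: word_eq_cat; apply: word_reprP. Qed.

Lemma pinvE u : pinv (word_class u) = word_class (word_inv u).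
Proof. by apply/word_classP; apply: word_eq_inv; apply: word_reprP. Qed.

Lemma pmulA : associative pmul.
Proof.
by move=> x y z; rewrite -[x]word_classK -[y]word_classK -[z]word_classK !pmulE catA.
Qed.

Lemma pmul1 : left_id pone pmul.
Proof. by move=> x; rewrite -[x]word_classK pmulE. Qed.

Lemma pmulr1 : right_id pone pmul.
Proof. by move=> x; rewrite -[x]word_classK pmulE cats0. Qed.

Lemma pmulV : left_inverse pone pinv pmul.
Proof.
by move=> x; rewrite -[x]word_classK pinvE pmulE; apply/word_classP/word_mulVw.
Qed.

Lemma pmulrV : right_inverse pone pinv pmul.
Proof.
by move=> x; rewrite -[x]word_classK pinvE pmulE; apply/word_classP/word_mulV.
Qed.

HB.instance Definition _ :=
  isGroup.Build presented pmulA pmul1 pmulr1 pmulV pmulrV.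

Lemma word_classM u v : word_class (u ++ v) = word_class u * word_class v.
Proof. by rewrite [RHS]pmulE. Qed.

Definition gen (a : I) : presented := word_class [:: (a, true)].

End Presentation.

Section SemidirectProduct.
Variables H G : groupType.

(* Each gact s is an automorphism: its inverse is gact s^-1. *)
Record group_action := GroupAction {
  gact :> H -> G -> G;
  gact1 : forall x, gact 1 x = x;
  gactM : forall s t x, gact (s * t) x = gact s (gact t x);
  gact_mul : forall s x y, gact s (x * y) = gact s x * gact s y }.

Definition semidirect (A : group_action) : Type := (G * H)%type.

Variable A : group_action.
HB.instance Definition _ := Choice.copy (semidirect A) (G * H)%type.

Implicit Types p q r : semidirect A.

Definition sdmul p q : semidirect A := (p.1 * A p.2 q.1, p.2 * q.2).
Definition sdone : semidirect A := (1, 1).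
Definition sdinv p : semidirect A := (A p.2^-1 p.1^-1, p.2^-1).

Lemma gact_one s : A s 1 = 1.
Proof. by apply: (mulgI (A s 1)); rewrite -gact_mul !mulg1. Qed.

Lemma sdmulA : associative sdmul.
Proof. by move=> p q r; rewrite /sdmul /= gact_mul gactM !mulgA. Qed.

Lemma sdmul1 : left_id sdone sdmul.
Proof. by case=> x s; rewrite /sdmul /= gact1 !mul1g. Qed.

Lemma sdmulr1 : right_id sdone sdmul.
Proof. by case=> x s; rewrite /sdmul /= gact_one !mulg1. Qed.

Lemma sdmulV : left_inverse sdone sdinv sdmul.
Proof.
by case=> x s; rewrite /sdmul /sdinv /= -gact_mul !mulVg gact_one.
Qed.

Lemma sdmulrV : right_inverse sdone sdinv sdmul.
Proof.
by case=> x s; rewrite /sdmul /sdinv /= -gactM !mulgV gact1 mulgV.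
Qed.

HB.instance Definition _ :=
  isGroup.Build (semidirect A) sdmulA sdmul1 sdmulr1 sdmulV sdmulrV.

End SemidirectProduct.

(* MathComp composes permutations from left to right, i.e., it has
   (s * t) i = t (s i) in 'S_n. A left action of the symmetric group needs
   the usual product (s * t) i = s (t i), which we put on a copy of 'S_n. *)
Section Symmetric.
Variable n : nat.

Definition symm : Type := 'S_n.
HB.instance Definition _ := Choice.copy symm 'S_n.

Definition symm_perm (s : symm) : 'S_n := s.
Coercion symm_perm : symm >-> perm_of.

Definition symm_mul (s t : symm) : symm := (symm_perm t * symm_perm s)%g.
Definition symm_one : symm := (1 : 'S_n)%g.
Definition symm_inv (s : symm) : symm := (symm_perm s)^-1%g.

Lemma symm_mulA : associative symm_mul.
Proof. by move=> s t u; rewrite /symm_mul /symm_perm mulgA. Qed.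
Lemma symm_mul1 : left_id symm_one symm_mul.
Proof. by move=> s; rewrite /symm_mul /symm_perm mulg1. Qed.
Lemma symm_mulr1 : right_id symm_one symm_mul.
Proof. by move=> s; rewrite /symm_mul /symm_perm mul1g. Qed.
Lemma symm_mulV : left_inverse symm_one symm_inv symm_mul.
Proof. by move=> s; rewrite /symm_mul /symm_perm mulgV. Qed.
Lemma symm_mulrV : right_inverse symm_one symm_inv symm_mul.
Proof. by move=> s; rewrite /symm_mul /symm_perm mulVg. Qed.

HB.instance Definition _ :=
  isGroup.Build symm symm_mulA symm_mul1 symm_mulr1 symm_mulV symm_mulrV.

Lemma symm1E i : (1 : symm) i = i.
Proof. exact: perm1. Qed.

Lemma symmME (s t : symm) i : (s * t) i = s (t i).
Proof. exact: permM. Qed.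

End Symmetric.

(* Indices are 0-based: sigma i and rho i, for i < n-1, are sigma_(i+1) and
   rho_(i+1). *)
Section UnrestrictedVirtualBraids.
Variable n : nat.

Definition uvb_gen : Type := ('I_n.-1 + 'I_n.-1)%type.
HB.instance Definition _ := Choice.on uvb_gen.

Definition sigma (i : 'I_n.-1) : uvb_gen * bool := (inl i, true).
Definition rho (i : 'I_n.-1) : uvb_gen * bool := (inr i, true).

Definition far (i j : 'I_n.-1) : bool := (i.+2 <= j) || (j.+2 <= i).

Inductive uvb_rel : word uvb_gen -> word uvb_gen -> Prop :=
| uvb_R1 (i j : 'I_n.-1) of j = i.+1 :> nat :
    uvb_rel [:: sigma i; sigma j; sigma i] [:: sigma j; sigma i; sigma j]
| uvb_R2 (i j : 'I_n.-1) of far i j :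
    uvb_rel [:: sigma i; sigma j] [:: sigma j; sigma i]
| uvb_R3 (i j : 'I_n.-1) of j = i.+1 :> nat :
    uvb_rel [:: rho i; rho j; rho i] [:: rho j; rho i; rho j]
| uvb_R4 (i j : 'I_n.-1) of far i j :
    uvb_rel [:: rho i; rho j] [:: rho j; rho i]
| uvb_R5 (i : 'I_n.-1) :
    uvb_rel [:: rho i; rho i] [::]
| uvb_R6 (i j : 'I_n.-1) of far i j :
    uvb_rel [:: sigma i; rho j] [:: rho j; sigma i]
| uvb_M (i j : 'I_n.-1) of j = i.+1 :> nat :
    uvb_rel [:: rho i; rho j; sigma i] [:: sigma j; rho i; rho j]
| uvb_F1 (i j : 'I_n.-1) of j = i.+1 :> nat :
    uvb_rel [:: rho i; sigma j; sigma i] [:: sigma j; sigma i; rho j]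
| uvb_F2 (i j : 'I_n.-1) of j = i.+1 :> nat :
    uvb_rel [:: rho j; sigma i; sigma j] [:: sigma i; sigma j; rho i].

Definition UVB : groupType := presented uvb_rel.

End UnrestrictedVirtualBraids.

Section RightAngledArtin.
Variable n : nat.

(* The pair (i, j) with i != j indexes the generator x_{i,j}. *)
Definition dpairs : Type := {p : 'I_n * 'I_n | p.1 != p.2}.
HB.instance Definition _ := Choice.on dpairs.

Inductive raag_rel : word dpairs -> word dpairs -> Prop :=
| raag_comm (a b : dpairs) of val b != ((val a).2, (val a).1) :
    raag_rel [:: (a, true); (b, true)] [:: (b, true); (a, true)].

Definition X : groupType := presented raag_rel.

Fact perm_dpair_proof (s : symm n) (a : dpairs) :
  (s (val a).1, s (val a).2).1 != (s (val a).1, s (val a).2).2.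
Proof. by rewrite /= (inj_eq perm_inj) (valP a). Qed.

Definition perm_dpair (s : symm n) (a : dpairs) : dpairs :=
  exist _ (s (val a).1, s (val a).2) (perm_dpair_proof s a).

Definition perm_word (s : symm n) (w : word dpairs) : word dpairs :=
  [seq (perm_dpair s l.1, l.2) | l <- w].

Definition X_act_fun (s : symm n) (x : X) : X :=
  word_class raag_rel (perm_word s (repr x)).

Lemma perm_word_eq s u v :
  word_eq raag_rel u v -> word_eq raag_rel (perm_word s u) (perm_word s v).
Proof.
elim=> {u v}.
- move=> u; exact: word_eq_refl.
- move=> u v _; exact: word_eq_sym.
- move=> u v w _ uv _ vw; exact: word_eq_trans uv vw.
- move=> u u' v v' _ uu' _ vv'; rewrite /perm_word !map_cat.
  exact: word_eq_cat.
- move=> l; exact: (word_eq_cancel _ (perm_dpair s l.1, l.2)).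
- move=> _ _ [a b ab]; apply/word_eq_rel/raag_comm; apply: contra ab.
  case/eqP=> /perm_inj e1 /perm_inj e2.
  by rewrite [val b]surjective_pairing e1 e2.
Qed.

Lemma X_act_class s u :
  X_act_fun s (word_class raag_rel u) = word_class raag_rel (perm_word s u).
Proof. by apply/word_classP; apply: perm_word_eq; apply: word_reprP. Qed.

Lemma X_act1 x : X_act_fun 1 x = x.
Proof.
rewrite -[x]word_classK X_act_class; congr word_class; rewrite -[RHS]map_id.
apply: eq_map => -[a b] /=; congr pair; apply: val_inj.
by rewrite /= !symm1E -surjective_pairing.
Qed.

Lemma X_actM s t x : X_act_fun (s * t) x = X_act_fun s (X_act_fun t x).
Proof.
rewrite -[x]word_classK !X_act_class /perm_word -map_comp; congr word_class.
apply: eq_map => -[a b] /=; congr pair; apply: val_inj.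
by rewrite /= !symmME.
Qed.

Lemma X_act_mul s x y : X_act_fun s (x * y) = X_act_fun s x * X_act_fun s y.
Proof.
rewrite -[x]word_classK -[y]word_classK -word_classM !X_act_class.
by rewrite -word_classM /perm_word map_cat.
Qed.

Definition X_act : group_action (symm n) X :=
  GroupAction X_act1 X_actM X_act_mul.

Lemma X_act_gen s a : X_act s (gen raag_rel a) = gen raag_rel (perm_dpair s a).
Proof. exact: X_act_class. Qed.

End RightAngledArtin.

(* Main.v *)
(* With x_{i,i+1} = sigma_i rho_i, relation F1 says that x_{i+1,i+2} and
   x_{i,i+2} commute, F2 that x_{i,i+1} and x_{i,i+2} commute, and then R1
   that x_{i,i+1} and x_{i+1,i+2} commute. So sigma_i |-> (x_{i,i+1}, s_i),
   rho_i |-> (1, s_i) is a morphism f to the semidirect product. For its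
   inverse, the rho_i satisfy the Coxeter relations of the symmetric group,
   hence the projection to S_n has a multiplicative section tau. Take the
   conjugate of sigma_(n-1) rho_(n-1) by tau s as the image of
   x_{s(n-1),s(n)}: it depends only on s(n-1) and s(n) because the
   stabilizer of n-1 and n is generated by rho_1, ..., rho_(n-3), which
   commute with sigma_(n-1) rho_(n-1). Up to conjugation, the relations of
   X_n only involve indices 1, ..., 4, where they follow from F1, F2, R1,
   R2, R4 and R6. *)
Require Import Defs.
From HB Require Import structures.
From mathcomp Require Import all_boot all_fingroup.
From mathcomp Require Import boolp.
From mathcomp Require Import zify.

Set Implicit Arguments.
Unset Strict Implicit.
Unset Printing Implicit Defensive.
Local Open Scope group_scope.

(** * Elementary facts about product-preserving maps *)

Section Morphism.

Variables (G H : groupType) (f : G -> H).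
Hypothesis fM : {morph f : x y / x * y}.

Lemma morph1 : f 1 = 1.
Proof. by apply: (mulgI (f 1)); rewrite -fM !mulg1. Qed.

Lemma morphV x : f x^-1 = (f x)^-1.
Proof. by apply/esym/mulg1_eq; rewrite -fM mulgV morph1. Qed.

End Morphism.

(** * Universal property of a group given by a presentation *)

Section Lifting.

Variables (I : choiceType) (R : word I -> word I -> Prop).

(** By induction on a representative word; a letter with sign [false] is the inverse of a
    generator. *)
Lemma presented_ind (P : presented R -> Prop) :
  P 1 -> (forall x y, P x -> P y -> P (x * y)) ->
  (forall x, P x -> P x^-1) -> (forall a, P (gen R a)) -> forall x, P x.
Proof.
move=> P1 PM PV Pg x; rewrite -[x]word_classK.
elim: (generic_quotient.repr x) => [|[a b] w IHw]; first exact: P1.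
rewrite -[_ :: w]/([:: (a, b)] ++ w) word_classM; apply: PM IHw.
case: b; first exact: Pg.
suff -> : word_class R [:: (a, false)] = (gen R a)^-1 by apply/PV/Pg.
apply/esym/mulg1_eq; rewrite -word_classM.
exact/word_classP/(word_eq_cancel R (a, true)).
Qed.

Lemma gen3 a b c : gen R a * gen R b * gen R c =
  word_class R [:: (a, true); (b, true); (c, true)].
Proof.
by rewrite [RHS](word_classM R [:: _; _] [:: _]) (word_classM R [:: _] [:: _]).
Qed.

Variables (G : groupType) (phi : I -> G).

Definition word_eval (w : word I) : G :=
  \prod_(l <- w) if l.2 then phi l.1 else (phi l.1)^-1.

Hypothesis phiR : forall u v, R u v -> word_eval u = word_eval v.

Lemma word_evalP u v : word_eq R u v -> word_eval u = word_eval v.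
Proof.
elim=> {u v} //; first by move=> u v w _ -> _ ->.
- by move=> u u' v v' _ e _ e'; rewrite /word_eval !big_cat; congr (_ * _).
- case=> a []; rewrite /word_eval !big_cons big_nil /flip /= mulg1.
    exact: mulgV.
  exact: mulVg.
Qed.

Definition lift (x : presented R) : G := word_eval (generic_quotient.repr x).

Lemma lift_class w : lift (word_class R w) = word_eval w.
Proof. exact/word_evalP/word_reprP. Qed.

Lemma liftM : {morph lift : x y / x * y}.
Proof.
move=> x y; rewrite -[x]word_classK -[y]word_classK -word_classM !lift_class.
exact: big_cat.
Qed.

Lemma lift_gen a : lift (gen R a) = phi a.
Proof. by rewrite lift_class /word_eval big_seq1. Qed.

End Lifting.

(** * Coxeter relations of the symmetric group and a multiplicative section of [p] *)

Section Coxeter.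

Variables (N : nat) (G : groupType) (r : nat -> G).
Variable p : G -> symm N.+1.

Hypothesis pM : {morph p : x y / x * y}.
Hypothesis rr : forall i, r i * r i = 1.
Hypothesis rC : forall i j, i.+1 < j -> r i * r j = r j * r i.
(** Bounded, unlike [rr] and [rC]: when [r] takes the value 1 from N on, the braid relation fails at
    i = N-1. *)
Hypothesis rB :
  forall i, i.+1 < N -> r i * r i.+1 * r i = r i.+1 * r i * r i.+1.
Hypothesis pr : forall i, i < N -> p (r i) = tperm (inord i) (inord i.+1).

(** The subgroup <r_0, ..., r_(m-1)>; positive words suffice because the generators are
    involutions. *)
Inductive rprod (m : nat) : G -> Prop :=
| rprod1 : rprod m 1
| rprodMr x i of i < m & rprod m x : rprod m (x * r i).

Lemma rprodM m x y : rprod m x -> rprod m y -> rprod m (x * y).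
Proof.
move=> Wx; elim=> [|{}y i im _ IH]; first by rewrite mulg1.
by rewrite mulgA; apply: rprodMr.
Qed.

Lemma rprod_gen m i : i < m -> rprod m (r i).
Proof. by move=> im; rewrite -[r i]mul1g; apply: rprodMr (rprod1 m). Qed.

Lemma rprodV m x : rprod m x -> rprod m x^-1.
Proof.
elim=> [|{}x i im _ IH]; first by rewrite invg1; apply: rprod1.
rewrite invgM; apply: rprodM IH.
by rewrite (mulg1_eq (rr i)); apply: rprod_gen.
Qed.

Lemma rprodS m m' x : m <= m' -> rprod m x -> rprod m' x.
Proof.
move=> mm'; elim=> [|{}x i im _ IH]; first exact: rprod1.
exact: rprodMr (leq_trans im mm') IH.
Qed.

Lemma pr_fix i k : i < N -> k <= N -> k != i -> k != i.+1 ->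
  p (r i) (inord k) = inord k.
Proof.
move=> iN kN ki ki1; rewrite pr //.
apply: tpermD; rewrite -val_eqE /= !inordK //; lia.
Qed.

Lemma prL i : i < N -> p (r i) (inord i) = inord i.+1.
Proof. by move=> iN; rewrite pr //; apply: tpermL. Qed.

Lemma pME x y i : p (x * y) i = p x (p y i).
Proof. by rewrite pM symmME. Qed.

Lemma p1E i : p 1 i = i.
Proof. by rewrite (morph1 pM) symm1E. Qed.

Lemma rprod_fix m x k : m <= N -> rprod m x -> m < k -> k <= N ->
  p x (inord k) = inord k.
Proof.
move=> mN Wx mk kN; elim: Wx => [|{}x i im _ IH]; first exact: p1E.
rewrite pME pr_fix //; lia.
Qed.

(* desc k j = r_(k+j-1) ... r_(k+1) r_k *)
Fixpoint desc (k j : nat) : G :=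
  if j is j'.+1 then r (k + j') * desc k j' else 1.

Lemma descSr k j : desc k j.+1 = desc k.+1 j * r k.
Proof.
elim: j => [|j IH]; first by rewrite /= addn0 mulg1 mul1g.
by rewrite -[LHS]/(r (k + j.+1) * desc k j.+1) IH mulgA /= addSnnS.
Qed.

Lemma desc_comml k j i : i.+1 < k -> desc k j * r i = r i * desc k j.
Proof.
move=> ik; elim: j => [|j IH]; first by rewrite mulg1 mul1g.
rewrite /= -mulgA IH !mulgA -rC //; lia.
Qed.

Lemma desc_commr k j i : k + j < i -> desc k j * r i = r i * desc k j.
Proof.
elim: j => [|j IH] kji; first by rewrite mulg1 mul1g.
rewrite /= -mulgA IH; last lia.
by rewrite !mulgA rC //; lia.
Qed.

(** [r i.+1] passes the factors of index below i, the braid relation turns r_(i+1) r_i r_(i+1) into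
    r_i r_(i+1) r_i, and [r i] passes the factors of index above i+1. *)
Lemma desc_shift k j i : k + j <= N -> k <= i -> i.+1 < k + j ->
  desc k j * r i.+1 = r i * desc k j.
Proof.
elim: j => [|j IH] kjN ki ikj; first lia.
have [ikj'|ikj'] := ltnP i.+1 (k + j).
  rewrite /= -mulgA IH //; last lia.
  by rewrite !mulgA -rC //; lia.
have {ikj ikj'} e : k + j = i.+1 by lia.
case: j kjN e {IH} => [|j] kjN e; first lia.
have e' : k + j = i by lia.
rewrite /= e e' -!mulgA desc_commr; last lia.
rewrite !mulgA rB //; lia.
Qed.

(* The cosets of <r_0, ..., r_(m-1)> in <r_0, ..., r_m> are represented by the
   m + 2 elements r_m r_(m-1) ... r_k. *)
Lemma rprod_coset m x : m < N -> rprod m.+1 x ->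
  exists k j y, [/\ k + j = m.+1, rprod m y & x = y * desc k j].
Proof.
move=> mN; elim=> [|{}x i im _ [k [j [y [kj Wy ->]]]]].
  by exists m.+1, 0, 1; rewrite addn0 mulg1; split=> //; apply: rprod1.
(* Multiplying by [r i] on the right: if i < k-1 it passes into [y]; if i = k-1 it lengthens [desc];
   if i = k it cancels the last factor; if i > k it passes into [y] as r_(i-1). *)
have [ik|ki] := ltnP i k.
  have [ik1|ik1] := ltnP i.+1 k.
    exists k, j, (y * r i); rewrite -!mulgA desc_comml //.
    by split=> //; apply: rprodMr => //; lia.
  have ek : k = i.+1 by lia.
  by exists i, j.+1, y; rewrite -mulgA descSr -ek; split=> //; lia.
have [ei|nei] := eqVneq i k.
  case: j kj => [|j] kj; first lia.
  exists k.+1, j, y; split=> //; first lia.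
  by rewrite descSr ei -!mulgA rr mulg1.
case: i im ki nei => [|i] im ki nei; first lia.
exists k, j, (y * r i); split=> //; first by apply: rprodMr => //; lia.
by rewrite -!mulgA desc_shift //; lia.
Qed.

Lemma p_desc k j : k + j <= N -> p (desc k j) (inord k) = inord (k + j).
Proof.
elim: j => [|j IH] kj; first by rewrite addn0 p1E.
by rewrite /= pME IH ?addnS ?prL //; lia.
Qed.

Lemma rprod_desc k j : rprod (k + j) (desc k j).
Proof.
elim: j => [|j IH]; first exact: rprod1.
apply: rprodM; first by apply: rprod_gen; lia.
by apply: rprodS IH; lia.
Qed.

(** Write x as [y * desc k j]: it sends k to m+1, since [y] fixes m+1. If x also fixes m+1, then k =
    m+1 and [desc] is empty. *)
Lemma rprod_stab1 m x : m < N -> rprod m.+1 x ->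
  p x (inord m.+1) = inord m.+1 -> rprod m x.
Proof.
move=> mN Wx; case: (rprod_coset mN Wx) => k [j [y [kj Wy ->]]] fx.
have : p (y * desc k j) (inord k) = inord m.+1.
  by rewrite pME p_desc kj // (rprod_fix _ Wy) //; lia.
rewrite -fx => /perm_inj/(congr1 val) /=; rewrite !inordK; try lia.
move=> ek; have -> : j = 0 by lia.
by rewrite mulg1.
Qed.

Lemma rprod_stab m x : m <= N -> rprod N x ->
  (forall k, m < k -> k <= N -> p x (inord k) = inord k) -> rprod m x.
Proof.
move=> mN Wx fx; have := subnKC mN; move: (N - m) => d.
elim: d m mN fx => [|d IH] m mN fx e; first by rewrite -[m]addn0 e.
apply: rprod_stab1; [lia| |apply: fx; lia].
by apply: IH; [lia|move=> k mk kN; apply: fx; lia|lia].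
Qed.

(** Faithfulness: the stabilizer of 1, ..., N is generated by no [r i] at all. *)
Lemma rprod_eq1 x : rprod N x -> p x = 1 -> x = 1.
Proof.
move=> Wx px; have : rprod 0 x.
  by apply: rprod_stab => // k _ _; rewrite px symm1E.
by case.
Qed.

Lemma rprod_inj x y : rprod N x -> rprod N y -> p x = p y -> x = y.
Proof.
move=> Wx Wy pxy; apply: divg1_eq; apply: rprod_eq1.
  exact: rprodM (rprodV Wy).
by rewrite pM (morphV pM) pxy mulgV.
Qed.

(** By induction on m for the permutations supported on 0, ..., m; at m = N every permutation
    qualifies. *)
Lemma rprod_surj (s : symm N.+1) : exists2 x, rprod N x & p x = s.
Proof.
suff H m : m <= N -> forall t : symm N.+1,
    (forall k, m < k -> k <= N -> t (inord k) = inord k) ->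
    exists2 x, rprod N x & p x = t.
  by apply: (H N (leqnn N)) => k k1 k2; lia.
elim: m => [|m IH] mN t ft.
  exists 1; first exact: rprod1.
  rewrite (morph1 pM); apply/permP => i; rewrite -[t i]/(symm_perm t i).
  have fix_pos (k : 'I_N.+1) : 0 < k -> t k = k.
    move=> k0; rewrite -{1}[k]inord_val ft ?inord_val //.
    by have := ltn_ord k; lia.
  rewrite [LHS]perm1; have [i0|i0] := posnP i; last by rewrite fix_pos.
  have [ti0|ti0] := posnP (t i); first by apply: val_inj; rewrite /= ti0.
  by apply/esym/(perm_inj (s := t))/fix_pos.
have [i ti] : exists i, t i = inord m.+1.
  by exists (t^-1 (inord m.+1)); rewrite -symmME mulgV symm1E.
have im : i <= m.+1.
  rewrite leqNgt; apply/negP => mi.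
  have := ft i mi; rewrite inord_val -ltnS ltn_ord => /(_ isT) ti'.
  have := congr1 val ti'; rewrite ti /= inordK; lia.
(* Both [t] and [p D] send i to m+1, so [t * (p D)^-1] fixes m+1 and falls under the induction
   hypothesis. *)
pose D := desc i (m.+1 - i).
have eD : i + (m.+1 - i) = m.+1 by rewrite subnKC.
have WD : rprod m.+1 D by rewrite -{1}eD; apply: rprod_desc.
have pD : p D i = inord m.+1 by rewrite -[i in LHS]inord_val p_desc eD.
case: (IH (ltnW mN) (t * (p D)^-1)) => [k mk kN|x Wx px].
  have [->|nk] := eqVneq k m.+1.
    by rewrite symmME -{1}pD -(symmME _ (p D)) mulVg symm1E ti.
  have fD : p D (inord k) = inord k by apply: rprod_fix WD _ _ => //; lia.
  by rewrite symmME -{1}fD -(symmME _ (p D)) mulVg symm1E ft //; lia.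
exists (x * D); first by apply: rprodM => //; apply: rprodS WD.
by rewrite pM px mulgVK.
Qed.

Definition rsection (s : symm N.+1) : G := s2val (cid2 (rprod_surj s)).

Lemma rprod_rsection s : rprod N (rsection s).
Proof. by rewrite /rsection; case: cid2. Qed.

Lemma rsectionK s : p (rsection s) = s.
Proof. by rewrite /rsection; case: cid2. Qed.

Lemma rsection_p x : rprod N x -> rsection (p x) = x.
Proof.
by move=> Wx; apply: rprod_inj => //; [apply: rprod_rsection|apply: rsectionK].
Qed.

Lemma rsectionM : {morph rsection : s t / s * t}.
Proof.
move=> s t; rewrite -{1}[s]rsectionK -{1}[t]rsectionK -pM rsection_p //.
by apply: rprodM; apply: rprod_rsection.
Qed.

End Coxeter.

(** * The morphism from the braid group to the semidirect product *)

Section UVBtoSemidirect.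

Variable N : nat.
Local Notation U := (UVB N.+1).
Local Notation XN := (X N.+1).
Local Notation SD := (semidirect (X_act N.+1)).

(* x_{i,j}, with the junk value 1 when i = j. *)
Definition xgen (i j : 'I_N.+1) : XN :=
  if insub (i, j) is Some d then gen (@raag_rel N.+1) d else 1.

Lemma xgenE (d : dpairs N.+1) :
  xgen (val d).1 (val d).2 = gen (@raag_rel N.+1) d.
Proof. by rewrite /xgen -surjective_pairing valK. Qed.

Lemma X_act_xgen (s : symm N.+1) i j : i != j ->
  X_act N.+1 s (xgen i j) = xgen (s i) (s j).
Proof.
move=> ij; rewrite -[i in LHS]/(i, j).1 -[j in LHS]/(i, j).2.
have -> : (i, j) = val (exist _ (i, j) ij : dpairs N.+1) by [].
by rewrite xgenE X_act_gen -xgenE.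
Qed.

Lemma xgenC i j k l : (k, l) != (j, i) -> commute (xgen i j) (xgen k l).
Proof.
move=> klji; rewrite /xgen; case: insubP => [d _ ed|_];
  last exact/commute_sym/commute1.
case: insubP => [e _ ee|_]; last exact: commute1.
rewrite /commute -!word_classM; apply/word_classP/word_eq_rel/raag_comm.
by rewrite ed ee.
Qed.

Definition adj (i : nat) : symm N.+1 := tperm (inord i) (inord i.+1).

(** Counterpart of [adj] on naturals: identities between products of [adj] become linear arithmetic
    through [swapP]. *)
Definition swap (i k : nat) : nat :=
  if k == i then i.+1 else if k == i.+1 then i else k.

Lemma swapP i k : k = i /\ swap i k = i.+1 \/ k = i.+1 /\ swap i k = i \/
  k <> i /\ k <> i.+1 /\ swap i k = k.
Proof.
rewrite /swap; case: eqP => [->|ki]; first by left.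
by case: eqP => [->|ki1]; right; [left|right].
Qed.

Lemma swapL i : swap i i = i.+1. Proof. by have := swapP i i; lia. Qed.

Lemma swapR i : swap i i.+1 = i. Proof. by have := swapP i i.+1; lia. Qed.

Lemma swapD i k : k != i -> k != i.+1 -> swap i k = k.
Proof. by have := swapP i k; lia. Qed.

Lemma swap_le i k : i < N -> k <= N -> swap i k <= N.
Proof. by have := swapP i k; lia. Qed.

Lemma adjE i k : i < N -> k <= N -> adj i (inord k) = inord (swap i k).
Proof.
move=> iN kN; rewrite /swap; case: eqVneq => [->|ki]; first exact: tpermL.
case: eqVneq => [->|ki1]; first exact: tpermR.
apply: tpermD; rewrite -val_eqE /= !inordK //; lia.
Qed.

Lemma symmP (s t : symm N.+1) :
  (forall k, k <= N -> s (inord k) = t (inord k)) -> s = t.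
Proof.
by move=> st; apply/permP => k; rewrite -[k]inord_val; apply/st/leq_ord.
Qed.

Lemma adjK i : adj i * adj i = 1.
Proof. exact: tperm2. Qed.

Lemma adjC i j : i < N -> j < N -> i.+1 < j -> adj i * adj j = adj j * adj i.
Proof.
move=> iN jN ij; apply: symmP => k kN; rewrite !symmME !adjE ?swap_le //.
congr inord; have := swapP j k; have := swapP i (swap j k).
have := swapP i k; have := swapP j (swap i k); lia.
Qed.

Lemma adjB i : i.+1 < N ->
  adj i * (adj i.+1 * adj i) = adj i.+1 * (adj i * adj i.+1).
Proof.
move=> iN; have iN' := ltnW iN; apply: symmP => k kN.
rewrite !symmME !adjE ?swap_le //.
congr inord; have := swapP i k; have := swapP i.+1 (swap i k).
have := swapP i (swap i.+1 (swap i k)); have := swapP i.+1 k.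
have := swapP i (swap i.+1 k); have := swapP i.+1 (swap i (swap i.+1 k)); lia.
Qed.

Definition xn (i j : nat) : XN := xgen (inord i) (inord j).

Lemma X_act_xn i k l : i < N -> k <= N -> l <= N -> k != l ->
  X_act N.+1 (adj i) (xn k l) = xn (swap i k) (swap i l).
Proof.
move=> iN kN lN kl; rewrite /xn X_act_xgen ?adjE //.
by rewrite -val_eqE /= !inordK.
Qed.

Lemma xnC i j k l : i <= N -> j <= N -> k <= N -> l <= N ->
  ~~ ((k == j) && (l == i)) -> xn i j * xn k l = xn k l * xn i j.
Proof.
move=> iN jN kN lN ne; apply: xgenC; apply: contra ne.
case/eqP => /(congr1 (@nat_of_ord _)) + /(congr1 (@nat_of_ord _)).
by rewrite !inordK // => -> ->; rewrite !eqxx.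
Qed.

Lemma X_act_braid i : i.+1 < N ->
  (X_act N.+1 (adj i) (xn i.+1 i.+2) = xn i i.+2) *
  (X_act N.+1 (adj i.+1) (xn i i.+1) = xn i i.+2) *
  (X_act N.+1 (adj i) (xn i i.+2) = xn i.+1 i.+2) *
  (X_act N.+1 (adj i.+1) (xn i i.+2) = xn i i.+1).
Proof.
move=> iN; do !split; rewrite X_act_xn ?swapL ?swapR ?swapD //; lia.
Qed.

Lemma X_act_far i j : i < N -> j < N -> (i.+1 < j) || (j.+1 < i) ->
  X_act N.+1 (adj i) (xn j j.+1) = xn j j.+1.
Proof. by move=> iN jN ij; rewrite X_act_xn ?swapD //; lia. Qed.

Lemma sdE (x y : XN) (s t : symm N.+1) :
  ((x, s) : SD) * (y, t) = (x * X_act N.+1 s y, s * t).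
Proof. by []. Qed.

Definition uvb_img (a : uvb_gen N.+1) : SD :=
  match a with
  | inl i => (xn i i.+1, adj i)
  | inr i => (1, adj i)
  end.

(* simpl would unfold X_act and block gact_mul, gact_one and X_act_braid. *)
Local Ltac expand :=
  rewrite /word_eval !big_cons big_nil; cbn [fst snd sigma rho uvb_img];
  rewrite !mulg1.

Lemma uvb_img_rel u v :
  @uvb_rel N.+1 u v -> word_eval uvb_img u = word_eval uvb_img v.
Proof.
have adjC' (i j : 'I_N) : @far N.+1 i j -> adj i * adj j = adj j * adj i.
  by case/orP=> ij; [|apply/esym]; apply: adjC.
case=> {u v} i.
- move=> j ji; expand.
  have iN : j < N := ltn_ord j; rewrite ji in iN *; rewrite !sdE; cbn [fst snd].
  congr pair; last exact: adjB.
  (* The components in X are x_{i,i+1} x_{i,i+2} x_{i+1,i+2} and the same product in reverse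
     order. *)
  rewrite !gact_mul !(X_act_braid iN) !mulgA [xn i.+1 i.+2 * _]xnC; try lia.
  rewrite [xn i i.+1 * _]xnC; try lia.
  by rewrite -!mulgA; congr (_ * _); apply: xnC; lia.
- move=> j ij; expand; rewrite !sdE.
  cbn [fst snd]; rewrite adjC' //.
  have iN : i < N := ltn_ord i; have jN : j < N := ltn_ord j.
  rewrite /far in ij; rewrite X_act_far // X_act_far 1?orbC // xnC //; lia.
- move=> j ji; expand.
  have iN : j < N := ltn_ord j; rewrite ji in iN *; rewrite !sdE; cbn [fst snd].
  by rewrite adjB // !(gact_one, mulg1).
- move=> j ij; expand; rewrite !sdE.
  cbn [fst snd]; rewrite adjC' //.
  by rewrite !(gact_one, mulg1).
- by expand; rewrite sdE adjK gact_one mulg1.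
- move=> j ij; expand; rewrite !sdE.
  cbn [fst snd]; rewrite adjC' //.
  have iN : i < N := ltn_ord i; have jN : j < N := ltn_ord j.
  by rewrite X_act_far 1?orbC // gact_one mulg1 mul1g.
- move=> j ji; expand.
  have iN : j < N := ltn_ord j; rewrite ji in iN *; rewrite !sdE; cbn [fst snd].
  by rewrite !(mul1g, mulg1, gact_mul, gact_one, X_act_braid iN) adjB.
- move=> j ji; expand.
  have iN : j < N := ltn_ord j; rewrite ji in iN *; rewrite !sdE; cbn [fst snd].
  rewrite !(mul1g, mulg1, gact_mul, gact_one, X_act_braid iN) adjB //.
  by rewrite xnC //; lia.
- move=> j ji; expand.
  have iN : j < N := ltn_ord j; rewrite ji in iN *; rewrite !sdE; cbn [fst snd].
  rewrite !(mul1g, mulg1, gact_mul, gact_one, X_act_braid iN) -adjB //.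
  by rewrite xnC //; lia.
Qed.

Definition uvb_hom : U -> SD := lift uvb_img.

Lemma uvb_homM : {morph uvb_hom : x y / x * y}.
Proof. exact: liftM uvb_img_rel. Qed.

Lemma uvb_hom_gen a : uvb_hom (gen (@uvb_rel N.+1) a) = uvb_img a.
Proof. exact: lift_gen uvb_img_rel a. Qed.

End UVBtoSemidirect.

(** * The morphism from the semidirect product to the braid group *)

Section SemidirectToUVB.

(* A, B and C = q A q are the images of x_{i,i+1}, x_{i+1,i+2} and x_{i,i+2};
   the last three hypotheses are F1, F2 and R1 for sigma_i = A r and
   sigma_(i+1) = B q. *)
Lemma flat_commute (G : groupType) (A B r q : G) :
  r * r = 1 -> q * q = 1 -> r * q * r = q * r * q -> q * A * q = r * B * r ->
  r * (B * q) * (A * r) = (B * q) * (A * r) * q ->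
  q * (A * r) * (B * q) = (A * r) * (B * q) * r ->
  (A * r) * (B * q) * (A * r) = (B * q) * (A * r) * (B * q) ->
  [/\ commute A (q * A * q), commute (q * A * q) B & commute A B].
Proof.
move=> rr qq rqr; move eC : (q * A * q) => C CB F1 F2 R1.
have qA : q * A = C * q by rewrite -eC -mulgA qq mulg1.
have rB : r * B = C * r by rewrite CB -mulgA rr mulg1.
have qC : q * C = A * q by rewrite -eC !mulgA qq mul1g.
have rC : r * C = B * r by rewrite CB !mulgA rr mul1g.
(* These rules move r and q to the right of A, B and C. *)
have push := (qA, rB, qC, rC).
have push' z : (z * q * A = z * C * q) * (z * r * B = z * C * r) *
    (z * q * C = z * A * q) * (z * r * C = z * B * r).
  by rewrite -!mulgA !push.
rewrite !(mulgA, push, push') in F1 F2 R1.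
(* The relations now read C B rqr = B C qrq, C A qrq = A C rqr and A C B rqr = B C A qrq; the braid
   relation cancels the tails. *)
have cancel x y : x * r * q * r = y * q * r * q -> x = y.
  by rewrite -!mulgA (mulgA q r q) -rqr -mulgA => /mulIg.
have cCB : commute C B := cancel _ _ F1.
have cCA : commute C A := esym (cancel _ _ (esym F2)).
have := cancel _ _ R1; rewrite -(cCA : C * A = A * C) -cCB -!mulgA.
move=> /mulgI cAB.
by split=> //; apply/commute_sym.
Qed.

Variable N : nat.
Local Notation U := (UVB N.+1).
Local Notation XN := (X N.+1).
Local Notation SD := (semidirect (X_act N.+1)).

(** Natural indices with junk value 1 fit the shape of [r] in the Coxeter section. *)
Definition rg (i : nat) : U :=
  if insub i is Some k then gen (@uvb_rel N.+1) (inr (k : 'I_N)) else 1.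
Definition sg (i : nat) : U :=
  if insub i is Some k then gen (@uvb_rel N.+1) (inl (k : 'I_N)) else 1.

Lemma rgE (i : 'I_N) : rg i = gen (@uvb_rel N.+1) (inr i).
Proof. by rewrite /rg valK. Qed.

Lemma sgE (i : 'I_N) : sg i = gen (@uvb_rel N.+1) (inl i).
Proof. by rewrite /sg valK. Qed.

Lemma uvb_relP u v : @uvb_rel N.+1 u v ->
  word_class (@uvb_rel N.+1) u = word_class (@uvb_rel N.+1) v.
Proof. by move=> uv; apply/word_classP/word_eq_rel. Qed.

Lemma rgK i : rg i * rg i = 1.
Proof.
rewrite /rg; case: insubP => [k _ _|_]; last exact: mulg1.
by rewrite -word_classM; apply: uvb_relP; apply: uvb_R5.
Qed.

Lemma rgC i j : i.+1 < j -> rg i * rg j = rg j * rg i.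
Proof.
move=> ij; rewrite /rg; case: insubP => [k _ ek|_]; last by rewrite mul1g mulg1.
case: insubP => [l _ el|_]; last by rewrite mul1g mulg1.
rewrite -!word_classM; apply: uvb_relP; apply: uvb_R4.
by rewrite /far [nat_of_ord k]ek [nat_of_ord l]el ij.
Qed.

Lemma sgC i j : i.+1 < j -> sg i * sg j = sg j * sg i.
Proof.
move=> ij; rewrite /sg; case: insubP => [k _ ek|_]; last by rewrite mul1g mulg1.
case: insubP => [l _ el|_]; last by rewrite mul1g mulg1.
rewrite -!word_classM; apply: uvb_relP; apply: uvb_R2.
by rewrite /far [nat_of_ord k]ek [nat_of_ord l]el ij.
Qed.

Lemma sg_rgC i j : (i.+1 < j) || (j.+1 < i) -> sg i * rg j = rg j * sg i.
Proof.
move=> ij; rewrite /rg /sg.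
case: insubP => [k _ ek|_]; last by rewrite mul1g mulg1.
case: insubP => [l _ el|_]; last by rewrite mul1g mulg1.
rewrite -!word_classM; apply: uvb_relP; apply: uvb_R6.
by rewrite /far [nat_of_ord k]ek [nat_of_ord l]el ij.
Qed.

Lemma uvb_rel3 i : i.+1 < N ->
  [/\ rg i * rg i.+1 * rg i = rg i.+1 * rg i * rg i.+1,
      sg i * sg i.+1 * sg i = sg i.+1 * sg i * sg i.+1,
      rg i * rg i.+1 * sg i = sg i.+1 * rg i * rg i.+1,
      rg i * sg i.+1 * sg i = sg i.+1 * sg i * rg i.+1 &
      rg i.+1 * sg i * sg i.+1 = sg i * sg i.+1 * rg i].
Proof.
move=> iN; set oi := Ordinal (ltnW iN); set oj := Ordinal iN.
rewrite (rgE oi : rg i = _) (rgE oj : rg i.+1 = _).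
rewrite (sgE oi : sg i = _) (sgE oj : sg i.+1 = _) !gen3.
by split; apply: uvb_relP; [apply: uvb_R3|apply: uvb_R1|apply: uvb_M|
  apply: uvb_F1|apply: uvb_F2].
Qed.

Lemma rgB i : i.+1 < N -> rg i * rg i.+1 * rg i = rg i.+1 * rg i * rg i.+1.
Proof. by case/uvb_rel3. Qed.

(** * Projection to the symmetric group and its section [tau] *)

Definition uvb_perm (x : U) : symm N.+1 := (uvb_hom x).2.

Lemma uvb_permM : {morph uvb_perm : x y / x * y}.
Proof. by move=> x y; rewrite /uvb_perm uvb_homM. Qed.

Lemma uvb_hom_rg i : i < N -> uvb_hom (rg i) = (1, adj N i).
Proof. by move=> iN; rewrite (rgE (Ordinal iN) : rg i = _) uvb_hom_gen. Qed.

Lemma uvb_perm_rg i : i < N -> uvb_perm (rg i) = tperm (inord i) (inord i.+1).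
Proof. by move=> iN; rewrite /uvb_perm uvb_hom_rg. Qed.

Definition tau : symm N.+1 -> U :=
  rsection uvb_permM uvb_perm_rg.

Lemma tauM : {morph tau : s t / s * t}.
Proof. exact: rsectionM rgK rgC rgB _. Qed.

Lemma tauV s : tau s^-1 = (tau s)^-1.
Proof. exact: morphV tauM s. Qed.

Lemma tau_rprod s : rprod rg N (tau s).
Proof. exact: rprod_rsection. Qed.

Lemma uvb_perm_tau s : uvb_perm (tau s) = s.
Proof. exact: rsectionK. Qed.

Lemma tau_adj i : i < N -> tau (adj N i) = rg i.
Proof.
move=> iN; have <- : uvb_perm (rg i) = adj N i := uvb_perm_rg iN.
by apply: (rsection_p _ rgK rgC rgB); apply: rprod_gen.
Qed.

Lemma uvb_hom_rprod m x : m <= N -> rprod rg m x -> (uvb_hom x).1 = 1.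
Proof.
move=> mN; elim=> [|{}x i im _ IH]; first by rewrite (morph1 (@uvb_homM N)).
rewrite uvb_homM uvb_hom_rg; last exact: leq_trans mN.
by rewrite [uvb_hom x]surjective_pairing IH sdE gact_one mulg1.
Qed.

Lemma uvb_hom_tau s : uvb_hom (tau s) = (1, s).
Proof.
rewrite [LHS]surjective_pairing (uvb_hom_rprod (leqnn N) (tau_rprod s)).
by congr pair; apply: uvb_perm_tau.
Qed.

(** * The elements of [U] that correspond to the x_{i,j}; [lam i] is the one for x_{i,i+1} *)

Definition lam (i : nat) : U := sg i * rg i.

Lemma lamC i j : i.+1 < j -> commute (lam i) (lam j).
Proof.
move=> ij; apply: commuteM; apply/commute_sym; apply: commuteM.
- exact/commute_sym/sgC.
- by apply: sg_rgC; rewrite ij orbT.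
- by apply/commute_sym/sg_rgC; rewrite ij.
- exact/commute_sym/rgC.
Qed.

Lemma lam_rgC i j : i.+1 < j -> commute (lam j) (rg i).
Proof.
move=> ij; apply/commute_sym/commuteM; last exact: rgC.
by apply/commute_sym/sg_rgC; rewrite ij orbT.
Qed.

Lemma uvb_hom_lam i : i < N -> uvb_hom (lam i) = (xn N i i.+1, 1).
Proof.
move=> iN; rewrite uvb_homM uvb_hom_rg // (sgE (Ordinal iN) : sg i = _).
by rewrite uvb_hom_gen /= sdE gact_one mulg1 adjK.
Qed.

(* The image of x_{s(N-1),s(N)}. *)
Definition lam_at (s : symm N.+1) : U := lam N.-1 ^ (tau s)^-1.

Lemma lam_atM s t : lam_at (s * t) = lam_at t ^ (tau s)^-1.
Proof. by rewrite /lam_at tauM invgM conjgM. Qed.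

(** The factors [rg i] of x have i at most N-3, hence at distance at least two from N-1. *)
Lemma lam_rprod_commute m x : rprod rg m x -> m <= N.-2 ->
  commute (lam N.-1) x.
Proof.
move=> Wx mN; elim: Wx => [|{}x i im _ IH]; first exact: commute1.
apply: commuteM IH _; apply: lam_rgC; lia.
Qed.

(** The quotient [u] fixes N-1 and N, so [rprod_stab] puts [tau u] in a subgroup that centralizes
    [lam N.-1]. *)
Lemma lam_at_eq (s t : symm N.+1) : s (inord N.-1) = t (inord N.-1) ->
  s (inord N) = t (inord N) -> lam_at s = lam_at t.
Proof.
move=> e1 e2; pose u := s^-1 * t; have -> : t = s * u by rewrite mulVKg.
rewrite lam_atM; congr (_ ^ _).
suff cu : commute (lam N.-1) (tau u).
  by rewrite /lam_at conjgE invgK (commuteV cu) mulVKg.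
apply: (lam_rprod_commute _ (leqnn _)).
apply: (rprod_stab uvb_permM rgK rgC rgB uvb_perm_rg); [lia|exact: tau_rprod|].
move=> k Nk kN; rewrite uvb_perm_tau /u symmME.
have [->|kN'] := eqVneq k N; first by rewrite -e2 -symmME mulVg symm1E.
have -> : k = N.-1 by lia.
by rewrite -e1 -symmME mulVg symm1E.
Qed.

(** [t] sends N-1 to i; a second transposition, which leaves i alone when i != j, then corrects the
    image of N to j. *)
Definition pair_perm (i j : 'I_N.+1) : symm N.+1 :=
  let t : symm N.+1 := tperm (inord N.-1) i in
  (tperm (t (inord N)) j : symm N.+1) * t.

Lemma distinct_gt0 (i j : 'I_N.+1) : i != j -> 0 < N.
Proof. by case: (N) i j => // i j; rewrite [i]ord1 [j]ord1 eqxx. Qed.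

Lemma pair_permL i j : i != j -> pair_perm i j (inord N.-1) = i.
Proof.
move=> ij; have N_gt0 := distinct_gt0 ij.
have tL : (tperm (inord N.-1) i : symm N.+1) (inord N.-1) = i := tpermL _ _.
rewrite /pair_perm symmME tL; apply: tpermD; last by rewrite eq_sym.
rewrite -[X in _ != X]tL (inj_eq perm_inj).
by rewrite -val_eqE /= !inordK; lia.
Qed.

Lemma pair_permR i j : pair_perm i j (inord N) = j.
Proof. by rewrite /pair_perm symmME; apply: tpermL. Qed.

Definition uvb_x (i j : 'I_N.+1) : U := lam_at (pair_perm i j).

Lemma uvb_x_eq (s : symm N.+1) i j :
  i != j -> s (inord N.-1) = i -> s (inord N) = j -> uvb_x i j = lam_at s.
Proof.
by move=> ij si sj; apply: lam_at_eq; rewrite ?pair_permL ?pair_permR.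
Qed.

Lemma uvb_x_conj (s : symm N.+1) i j :
  i != j -> uvb_x i j ^ (tau s)^-1 = uvb_x (s i) (s j).
Proof.
move=> ij; rewrite -lam_atM; apply/esym/uvb_x_eq.
- by rewrite (inj_eq perm_inj).
- by rewrite symmME pair_permL.
- by rewrite symmME pair_permR.
Qed.

Lemma inord_neq k l : k <= N -> l <= N -> k != l ->
  inord k != inord l :> 'I_N.+1.
Proof. by move=> kN lN kl; rewrite -val_eqE /= !inordK. Qed.

(** Downward induction from i = N-1. Conjugation by s_(i+1) s_i sends (i+1, i+2) to (i, i+1), and M
    with the braid relation of the rho shows that it carries [lam i.+1] to [lam i]. *)
Lemma uvb_x_adj i : i < N -> uvb_x (inord i) (inord i.+1) = lam i.
Proof.
move=> iN; have := subnKC iN; move: (N - _) => d.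
elim: d i iN => [|d IH] i iN e.
  have [eN eN'] : inord N = inord i.+1 :> 'I_N.+1 /\ N.-1 = i.
    by split; [congr inord; lia|lia].
  rewrite (@uvb_x_eq 1) ?symm1E ?eN ?eN' //; last by apply: inord_neq; lia.
  by rewrite /lam_at (morph1 tauM) invg1 conjg1 eN'.
have iN' : i.+1 < N by lia.
have := IH i.+1 iN' ltac:(lia).
move/(congr1 (fun x => x ^ (tau (adj N i.+1 * adj N i))^-1)).
rewrite uvb_x_conj; last by apply: inord_neq; lia.
rewrite !symmME !adjE ?swap_le; try lia.
rewrite swapR (@swapD i i.+2) ?swapR ?swapD; try lia.
move=> ->; rewrite tauM !tau_adj //.
case: (uvb_rel3 iN') => B _ M _ _; rewrite conjgE invgK invgM.
rewrite !(mulg1_eq (rgK _)) /lam.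
have rK k x : rg k * (rg k * x) = x by rewrite mulgA rgK mul1g.
have -> : sg i.+1 = rg i * rg i.+1 * sg i * (rg i.+1 * rg i).
  by rewrite M -!mulgA rK rgK mulg1.
by rewrite -!mulgA in B *; rewrite !rK -B !rK.
Qed.

(** * Commutation of the [uvb_x], reduced to the indices 0, ..., 3 by conjugation *)

Lemma symm_seq (t : seq 'I_N.+1) : uniq t -> size t <= N.+1 /\
  exists s : symm N.+1, forall k, k < size t -> s (inord k) = nth ord0 t k.
Proof.
elim/last_ind: t => [|t x IH]; first by split=> //; exists 1.
move=> tx_uniq; have t_size : size (rcons t x) <= N.+1.
  by have /card_uniqP<- := tx_uniq; rewrite -[leqRHS]card_ord max_card.
split=> //; move: tx_uniq t_size; rewrite rcons_uniq size_rcons.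
case/andP=> xt /IH[_ [s st]] tN.
(* The transposition corrects the image of position [size t]; it leaves the earlier values alone
   because [s] is injective and [x] is not in [t]. *)
exists ((tperm (s (inord (size t))) x : symm N.+1) * s) => k.
rewrite symmME ltnS leq_eqVlt nth_rcons => /predU1P[->|kt].
  by rewrite ltnn eqxx; apply: tpermL.
rewrite kt -(st k kt); apply: tpermD.
  by rewrite (inj_eq perm_inj); apply: inord_neq; lia.
by rewrite st //; apply: contraNneq xt => ->; apply: mem_nth.
Qed.

Lemma uvb_x_commute_conj (s : symm N.+1) i j k l : i != j -> k != l ->
  commute (uvb_x i j) (uvb_x k l) ->
  commute (uvb_x (s i) (s j)) (uvb_x (s k) (s l)).
Proof. by move=> ij kl c; rewrite -!uvb_x_conj // /commute -!conjMg c. Qed.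

Lemma uvb_x_rg k i j : k < N -> i <= N -> j <= N -> i != j ->
  rg k * uvb_x (inord i) (inord j) * rg k
    = uvb_x (inord (swap k i)) (inord (swap k j)).
Proof.
move=> kN iN jN ij; rewrite -(adjE kN iN) -(adjE kN jN).
rewrite -uvb_x_conj; last by apply: inord_neq.
rewrite tau_adj // (mulg1_eq (rgK k)) (conjgE (uvb_x _ _)) (mulg1_eq (rgK k)).
exact/esym/mulgA.
Qed.

Lemma lam_rg i : lam i * rg i = sg i.
Proof. by rewrite -mulgA rgK mulg1. Qed.

(** Conjugating [lam 0] by [rg 1] and [lam 1] by [rg 0] both give the element for (0, 2), so
    [flat_commute] applies. *)
Lemma uvb_x_braid : 1 < N ->
  [/\ commute (uvb_x (inord 0) (inord 1)) (uvb_x (inord 0) (inord 2)),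
      commute (uvb_x (inord 0) (inord 2)) (uvb_x (inord 1) (inord 2)) &
      commute (uvb_x (inord 0) (inord 1)) (uvb_x (inord 1) (inord 2))].
Proof.
move=> N1; rewrite !uvb_x_adj //; last lia.
have e1 : rg 1 * lam 0 * rg 1 = uvb_x (inord 0) (inord 2).
  by rewrite -uvb_x_adj ?uvb_x_rg; try lia.
have e0 : rg 0 * lam 1 * rg 0 = uvb_x (inord 0) (inord 2).
  by rewrite -uvb_x_adj ?uvb_x_rg; try lia.
case: (uvb_rel3 N1) => B R1 _ F1 F2.
rewrite -e1; apply: (@flat_commute _ _ _ (rg 0)); rewrite ?rgK ?lam_rg //.
by rewrite e0.
Qed.

Lemma uvb_x_commute i j k l : i != j -> k != l -> (k, l) != (j, i) ->
  commute (uvb_x i j) (uvb_x k l).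
Proof.
have tri t : uniq t -> 2 < size t -> 1 < N /\ exists s : symm N.+1,
    forall k, k < size t -> s (inord k) = nth ord0 t k.
  by move=> /symm_seq[tN st] t2; split=> //; apply: leq_trans t2 tN.
(* Three distinct indices: pairs with a common first index, with a common second index, or
   chained. *)
have fork i' j' l' : i' != j' -> i' != l' -> j' != l' ->
    [/\ commute (uvb_x i' j') (uvb_x i' l'),
        commute (uvb_x i' l') (uvb_x j' l') &
        commute (uvb_x i' j') (uvb_x j' l')].
  move=> ij il jl; have ijl : uniq [:: i'; j'; l'].
    by rewrite /= !inE negb_or ij il jl.
  case: (tri _ ijl isT) => N1 [s st].
  have [c1 c2 c3] := uvb_x_braid N1.
  have [d01 d02 d12] : [/\ inord 0 != inord 1 :> 'I_N.+1,
      inord 0 != inord 2 :> 'I_N.+1 & inord 1 != inord 2 :> 'I_N.+1].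
    by split; apply: inord_neq; lia.
  rewrite -[i'](st 0 isT) -[j'](st 1%N isT) -[l'](st 2 isT).
  by split; apply: uvb_x_commute_conj.
move=> ij kl klji.
have [eki|] := eqVneq i k.
  rewrite -eki in kl *; have [->|jl] := eqVneq j l; first exact: commute_refl.
  by have [] := fork i j l ij kl jl.
move=> ik; have [elj|jl] := eqVneq j l.
  by rewrite -elj in kl *; have [] := fork i k j ik ij kl.
have [ekj|jk] := eqVneq j k.
  rewrite -ekj in kl klji *.
  have il : i != l by apply: contraNneq klji => ->; rewrite eqxx.
  by have [] := fork i j l ij il kl.
have [eli|il] := eqVneq i l.
  rewrite -eli in kl *; rewrite eq_sym in jk.
  by have [_ _ /commute_sym] := fork k i j kl jk ij.
(* Four distinct indices are carried to 0, 1, 2, 3, where [lam 0] and [lam 2] commute as far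
   generators. *)
have t_uniq : uniq [:: i; j; k; l].
  by rewrite /= !inE !negb_or ij ik il jk jl kl.
have [N3 [s st]] := symm_seq t_uniq.
rewrite -[i](st 0 isT) -[j](st 1%N isT) -[k](st 2 isT) -[l](st 3 isT).
have {}N3 : 2 < N := N3.
apply: uvb_x_commute_conj; try by apply: inord_neq; lia.
by rewrite !uvb_x_adj; try lia; apply: lamC.
Qed.

(** * The inverse map and the two cancellation laws *)

Definition uvb_x_pair (d : dpairs N.+1) : U := uvb_x (val d).1 (val d).2.

Definition psi : XN -> U := lift uvb_x_pair.

Lemma psi_rel u v : @raag_rel N.+1 u v ->
  word_eval uvb_x_pair u = word_eval uvb_x_pair v.
Proof.
case=> a b ab; rewrite /word_eval !big_cons big_nil !mulg1.
apply: uvb_x_commute; [exact: (valP a)|exact: (valP b)|].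
by rewrite -surjective_pairing.
Qed.

Lemma psiM : {morph psi : x y / x * y}.
Proof. exact: liftM psi_rel. Qed.

Lemma psi_gen d : psi (gen (@raag_rel N.+1) d) = uvb_x (val d).1 (val d).2.
Proof. exact: lift_gen psi_rel d. Qed.

Lemma psi_xgen i j : i != j -> psi (xgen i j) = uvb_x i j.
Proof. by move=> ij; rewrite (xgenE (exist _ (i, j) ij)) psi_gen. Qed.

(** Equivariance, checked on generators by [uvb_x_conj]; this is what makes [uvb_inv]
    multiplicative. *)
Lemma psi_act s x : psi (X_act N.+1 s x) = psi x ^ (tau s)^-1.
Proof.
elim/presented_ind: x => [|x y IHx IHy|x IHx|d].
- by rewrite gact_one (morph1 psiM) conj1g.
- by rewrite gact_mul !psiM IHx IHy conjMg.
- by rewrite (morphV (gact_mul (X_act N.+1) s)) !(morphV psiM) IHx conjVg.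
- by rewrite X_act_gen !psi_gen uvb_x_conj //; apply: (valP d).
Qed.

Definition uvb_inv (p : SD) : U := psi p.1 * tau p.2.

Lemma uvb_invM : {morph uvb_inv : p q / p * q}.
Proof.
case=> [x s] [y t]; rewrite /uvb_inv sdE psiM psi_act tauM conjgE invgK.
by rewrite !mulgA mulgVK.
Qed.

Lemma uvb_homK : cancel (@uvb_hom N) uvb_inv.
Proof.
elim/presented_ind => [|x y IHx IHy|x IHx|].
- by rewrite (morph1 (@uvb_homM N)) (morph1 uvb_invM).
- by rewrite uvb_homM uvb_invM IHx IHy.
- by rewrite (morphV (@uvb_homM N)) (morphV uvb_invM) IHx.
(* On generators, sigma_i goes to (x_{i,i+1}, s_i) and back to [lam i * rg i], which is [sg i]. *)
case=> i; have iN : i < N := ltn_ord i.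
  rewrite uvb_hom_gen /uvb_inv psi_xgen; last by apply: inord_neq => //; lia.
  by rewrite uvb_x_adj // tau_adj // lam_rg sgE.
by rewrite uvb_hom_gen /uvb_inv (morph1 psiM) mul1g tau_adj // rgE.
Qed.

Lemma uvb_hom_psi x : uvb_hom (psi x) = (x, 1).
Proof.
elim/presented_ind: x => [|x y IHx IHy|x IHx|d].
- by rewrite (morph1 psiM) (morph1 (@uvb_homM N)).
- by rewrite psiM uvb_homM IHx IHy sdE Defs.gact1 mulg1.
- have -> : psi x^-1 = (psi x)^-1 := morphV psiM x.
  rewrite (morphV (@uvb_homM N)) IHx.
  by apply: mulg1_eq; rewrite sdE Defs.gact1 mulgV mulg1.
(* Two distinct indices force N > 0, so [lam N.-1] maps to x_{N-1,N}; [pair_perm] then moves it to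
   the generator [d]. *)
have N_gt0 := distinct_gt0 (valP d).
rewrite psi_gen /uvb_x /lam_at conjgE invgK -tauV (uvb_homM (tau _)).
rewrite (uvb_homM (lam _)) !uvb_hom_tau.
rewrite uvb_hom_lam ?prednK // !sdE !(mul1g, gact_one, mulg1) mulgV /xn.
rewrite X_act_xgen; last by apply: inord_neq; lia.
by rewrite pair_permL ?pair_permR ?xgenE //; apply: (valP d).
Qed.

Lemma uvb_invK : cancel uvb_inv (@uvb_hom N).
Proof.
case=> x s; rewrite /uvb_inv uvb_homM uvb_hom_psi uvb_hom_tau sdE.
by rewrite Defs.gact1 mulg1 mul1g.
Qed.

End SemidirectToUVB.

Theorem theorem2p4 (n : nat) (hn : 0 < n) :
  exists f : {multiplicative UVB n -> semidirect (X_act n)}, bijective f.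
Proof.
case: n hn => // N _.
pose F := isMultiplicative.Build _ _ _ (@uvb_homM N).
pose f : {multiplicative UVB N.+1 -> semidirect (X_act N.+1)} :=
  HB.pack (@uvb_hom N) F.
by exists f; exists (@uvb_inv N); [apply: uvb_homK|apply: uvb_invK].
Qed.
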